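(* Let $k\ge 1$ and let $X=(X_t)_{t\ge 0}$ be the $\mathcal C_k$-valued random walk with generator $\mathcal A$ on a simplicial complex. For any $t>0$, $X_t$ remains in the same homology class as $X_0$, i.e. $X_t-X_0\in \operatorname{im}\partial_{k+1}$. Moreover, if $X_0\in\ker\partial_k$, then $X_t\in\ker\partial_k$ for any $t\ge 0$.
   Context: Let $\mathbf C$ be a simplicial complex on a finite or countable totally ordered vertex set $V$. Oriented $k$-simplexes are written $[v_0,\dots,v_k]$ and change sign when two vertices are exchanged. $\mathcal S_k$ is the set of all oriented $k$-simplexes (both orientations), and $\mathcal S_k^+$ is the subset of those with $v_0<\dots<v_k$. $\mathcal C_k$ is the real vector space of $k$-chains $\sigma=\sum_{\tau\in\mathcal S_k^+}\lambda_\tau(\sigma)\tau$, with the inner product for which $\mathcal S_k^+$ is an orthonormal basis. $\mathcal C^k$ is its dual, identified with $\mathcal C_k$ through this inner product ($\eta^*$ denotes the cochain associated with a chain $\eta$), and $\langle f,\sigma\rangle_{\mathcal C^k,\mathcal C_k}=f(\sigma)$. The boundary map $\partial_k:\mathcal C_k\to\mathcal C_{k-1}$ is linear with $\partial_k[v_0,\dots,v_k]=\sum_{i=0}^k(-1)^i[v_0,\dots,v_{i-1},v_{i+1},\dots,v_k]$, and $\partial_0=0$; one has $\partial_k\circ\partial_{k+1}=0$. Random walk: for $\sigma\in\mathcal C_k$ and $\tau\in\mathcal S_{k+1}$ put $w(\sigma,\partial_{k+1}\tau)=\max(\langle(\partial_{k+1}\tau)^*,\sigma\rangle_{\mathcal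 C^k,\mathcal C_k},0)$. Write $\sigma\sim\sigma'$ if there is $\tau\in\mathcal S_{k+1}$ with $w(\sigma,\partial_{k+1}\tau)>0$ and $\sigma'=\sigma-\partial_{k+1}\tau$; then set $K(\sigma,\sigma')=w(\sigma,\sigma-\sigma')$. Set $K(0,0)=1$, and $K(\sigma,\sigma')=0$ in all other cases. The process $X$ is the continuous-time pure-jump Markov process on $\mathcal C_k$ with generator $\mathcal AF(\sigma)=\sum_{\sigma'\sim\sigma}(F(\sigma')-F(\sigma))K(\sigma,\sigma')$, i.e. from $\sigma$ it jumps to $\sigma-\partial_{k+1}\tau$ at rate $w(\sigma,\partial_{k+1}\tau)$. *)

(* Defs.v *)
From HB Require Import structures.
From mathcomp Require Import all_boot all_order all_algebra all_fingroup finmap.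
From mathcomp Require Import zify.
From mathcomp Require Import all_classical all_reals all_analysis.
From mathcomp Require Import measurable_realfun.
(* The notation levels of monalg clash with those of MathComp-Analysis. *)
From mathcomp.multinomials Require Import -(notations) monalg.

Set Implicit Arguments.
Unset Strict Implicit.
Unset Printing Implicit Defensive.

Import Order.TTheory GRing.Theory Num.Theory.
Import numFieldNormedType.Exports.

Local Open Scope classical_set_scope.
Local Open Scope ring_scope.

Record complex (d : Order.disp_t) (V : orderType d) := Complex {
  faces :> {pred {fset V}};
  faces_neq0 : forall A : {fset V}, A \in faces -> A != fset0;
  faces_vertex : forall v : V, [fset v]%fset \in faces;
  faces_sub : forall A B : {fset V},
    A \in faces -> B != fset0 -> (B `<=` A)%fset -> B \in faces
}.

Section Chains.
Context (R : realType) (d : Order.disp_t) (V : orderType d) (C : complex V).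

(* An unordered k-simplex stands for its increasing orientation, so this type
   is S_k^+. *)
Definition simplex (k : nat) : Type :=
  {A : {fset V} | (A \in C) && (#|` A| == k.+1)}.

HB.instance Definition _ k := Choice.on (simplex k).

(* Finitely supported families of reals indexed by S_k^+; the coefficient
   lambda_A(sigma) is [mcoeff A sigma]. *)
Definition chain (k : nat) : Type := @malg (simplex k) R.

HB.instance Definition _ k := GRing.Lmodule.on (chain k).
HB.instance Definition _ k := isPointed.Build (chain k) 0.

Definition coordinate_cylinders (k : nat) : set (set (chain k)) :=
  [set D | exists (A : simplex k) (U : set R),
     measurable U /\ D = [set sigma | U (mcoeff A sigma)]].

HB.instance Definition _ k :=
  @isMeasurable.Build (sigma_display (@coordinate_cylinders k)) (chain k)
    <<s @coordinate_cylinders k >> (@sigma_algebra0 _ setT _)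
    (@sigma_algebraC _ _) (@sigma_algebra_bigcup _ setT _).

Definition inversions (n : nat) (v : n.-tuple V) : nat :=
  #|[set p : 'I_n * 'I_n | (p.1 < p.2)%N && (tnth v p.2 < tnth v p.1)%O]%SET|.

(* The chain [v_0, ..., v_k]: the sign of the permutation that sorts v, times
   the basis vector of the simplex {v_0, ..., v_k}. It is 0 when the v_i do
   not span a k-simplex of C, in particular when two of them coincide. *)
Definition osimplex (k : nat) (v : k.+1.-tuple V) : chain k :=
  if insub [fset x in tval v]%fset is Some A
  then (-1) ^+ inversions v *: mkmalgU A 1 else 0.

Definition oriented_simplexes (k : nat) : set (chain k) :=
  [set osimplex v | v in [set v : k.+1.-tuple V |
                           uniq v /\ [fset x in tval v]%fset \in C]].

Lemma size_vertices (k : nat) (A : simplex k) :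
  size (sort <=%O (val A)) == k.+1.
Proof. by rewrite size_sort; case/andP: (valP A). Qed.

Definition vertices (k : nat) (A : simplex k) : k.+1.-tuple V :=
  Tuple (size_vertices A).

Definition face (n : nat) (i : 'I_n.+1) (v : n.+1.-tuple V) : n.-tuple V :=
  [tuple tnth v (lift i j) | j < n].

(* The linear extension from S_k^+; [boundary_osimplex] below shows that the
   usual formula then holds for every ordering of the vertices. *)
Definition boundary (k : nat) : chain k -> chain k.-1 :=
  match k return chain k -> chain k.-1 with
  | 0 => fun=> 0
  | j.+1 => fun sigma => \sum_(A <- msupp sigma) mcoeff A sigma *:
      \sum_(i < j.+2) (-1) ^+ i *: osimplex (face i (vertices A))
  end.

Lemma boundaryEw (k : nat) (D : {fset simplex k.+1}) (sigma : chain k.+1) :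
  (msupp sigma `<=` D)%fset -> boundary sigma =
  \sum_(A <- D) mcoeff A sigma *:
     \sum_(i < k.+2) (-1) ^+ i *: osimplex (face i (vertices A)).
Proof.
move=> sD; apply: big_fset_incl => // A _ /mcoeff_outdom ->.
by rewrite scale0r.
Qed.

Lemma boundary_is_linear (k : nat) : linear (@boundary k).
Proof.
case: k => [|k] a s t; first by rewrite /= scaler0 addr0.
pose D := (msupp s `|` msupp t `|` msupp (a *: s + t))%fset.
rewrite !(@boundaryEw _ D); last 3 first.
- by apply/fsubsetP => A; rewrite !inE => ->; rewrite ?orbT.
- by apply/fsubsetP => A; rewrite !inE => ->; rewrite ?orbT.
- by apply/fsubsetP => A; rewrite !inE => ->; rewrite ?orbT.
rewrite scaler_sumr -big_split; apply: eq_bigr => A _ /=.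
by rewrite mcoeffD mcoeffZ scalerA scalerDl.
Qed.

Lemma inversionsE n (v : n.-tuple V) : inversions v =
  (\sum_(a < n) \sum_(b < n) ((a < b) && (tnth v b < tnth v a)%O))%N.
Proof.
rewrite /inversions pair_big -sum1_card big_mkcond /=.
by apply: eq_bigr => p _; rewrite inE; case: ifP.
Qed.

Lemma tnth_face n (i : 'I_n.+1) (v : n.+1.-tuple V) j :
  tnth (face i v) j = tnth v (lift i j).
Proof. by rewrite tnth_mktuple. Qed.

Lemma sum_ltn_ord n (i : 'I_n.+1) : (nat_of_ord i = \sum_(j < n.+1) (j < i)%N)%N.
Proof.
  rewrite -(big_mkord xpredT (fun j => nat_of_bool (j < i)%N)) (big_cat_nat (n := i)) //=; last by rewrite ltnW.
  rewrite [X in (_ + X)%N]big_nat_cond [X in (_ + X)%N]big1 ?addn0; last first.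
    by move=> j /andP[/andP[]]; rewrite leqNgt => /negbTE ->.
  rewrite big_nat_cond (eq_bigr (fun=> 1%N)); last by move=> j /andP[/andP[_ ->]].
  by rewrite -big_nat_cond sum_nat_const_nat subn0 muln1.
Qed.

Lemma inversions_face n (i : 'I_n.+1) (v : n.+1.-tuple V) : uniq v ->
  exists m : nat, (inversions v + \sum_(j < n.+1) (tnth v j < tnth v i)%O =
    inversions (face i v) + i + m.*2)%N.
Proof.
move=> uv; rewrite !inversionsE.
exists (\sum_(j < n.+1) ((i < j) && (tnth v j < tnth v i)%O))%N.
rewrite [in LHS](bigD1_ord i) //= -addnA.
have -> : (\sum_(a < n) \sum_(b < n.+1)
     ((lift i a < b) && (tnth v b < tnth v (lift i a))%O) =
  \sum_(a < n) \sum_(b < n) ((a < b) && (tnth (face i v) b < tnth (face i v) a)%O) +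
  \sum_(a < n.+1) ((a < i) && (tnth v i < tnth v a)%O))%N.
  rewrite [in X in (_ = _ + X)%N](bigD1_ord i) //= ltnn add0n -big_split /=.
  apply: eq_bigr => a _; rewrite (bigD1_ord i) //= addnC; congr (_ + _)%N.
  apply: eq_bigr => b _; rewrite !tnth_face /bump; congr (nat_of_bool (_ && _)).
  lia.
have Ei := sum_ltn_ord i.
suff E : (\sum_(j < n.+1) ((i < j)%N && (tnth v j < tnth v i)%O) +
    \sum_(j < n.+1) ((j < i)%N && (tnth v i < tnth v j)%O) +
    \sum_(j < n.+1) (tnth v j < tnth v i)%O = i +
    (\sum_(j < n.+1) ((i < j)%N && (tnth v j < tnth v i)%O)).*2)%N.
  by rewrite -!addnA in E *; rewrite addnCA E addnA.
rewrite [X in _ = (X + _)%N]Ei -addnn -!big_split /=; apply: eq_bigr => j _ /=.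
have [->|ji] := eqVneq j i; first by rewrite ltxx ltnn.
have vji : tnth v j != tnth v i by apply: contra_neq ji => /(tuple_uniqP _ uv).
have {}ji : nat_of_ord j != i by [].
case: (ltngtP j i) ji => // ji _;
  by case: (ltgtP (tnth v j) (tnth v i)) vji.
Qed.

Lemma osimplexE (k : nat) (v : k.+1.-tuple V) (A : simplex k) :
  val A = [fset x in tval v]%fset ->
  osimplex v = (-1) ^+ inversions v *: mkmalgU A 1.
Proof. by move=> eA; rewrite /osimplex -eA valK. Qed.

Lemma boundaryU (k : nat) (A : simplex k.+1) :
  boundary (mkmalgU A 1 : chain k.+1) =
  \sum_(i < k.+2) (-1) ^+ i *: osimplex (face i (vertices A)).
Proof.
rewrite (@boundaryEw _ [fset A]%fset) ?msuppU_le//.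
by rewrite big_seq_fset1 mcoeffUU scale1r.
Qed.

Lemma mem_face n (i : 'I_n.+1) (v : n.+1.-tuple V) x : uniq v ->
  (x \in face i v) = (x \in v) && (x != tnth v i).
Proof.
move=> /tuple_uniqP uv; apply/tnthP/andP => [[j ->]|[/tnthP[j ->] ji]].
  rewrite tnth_face mem_tnth; split => //.
  by apply: contraNneq (neq_lift i j) => /uv ->.
have {}ji : i != j by apply: contra_neq ji => ->.
by have [j' ->] := unlift_some ji; exists j'; rewrite tnth_face.
Qed.

Lemma uniq_face n (i : 'I_n.+1) (v : n.+1.-tuple V) : uniq v -> uniq (face i v).
Proof.
move=> /tuple_uniqP uv; apply/tuple_uniqP => a b.
by rewrite !tnth_face => /uv /lift_inj.
Qed.

Lemma boundary_osimplex (k : nat) (v : k.+2.-tuple V) :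
  uniq v -> [fset x in tval v]%fset \in C ->
  boundary (osimplex v : chain k.+1) =
  \sum_(i < k.+2) (-1) ^+ i *: osimplex (face i v).
Proof.
move=> uv vC.
have hA : ([fset x in tval v]%fset \in C) && (#|` [fset x in tval v]%fset| == k.+2).
  by rewrite vC card_fseq undup_id // size_tuple eqxx.
pose A : simplex k.+1 :=
  exist (fun A : {fset V} => (A \in C) && (#|` A| == k.+2)) _ hA.
have mA x : (x \in vertices A) = (x \in v) by rewrite mem_sort !inE.
have uA : uniq (vertices A) by rewrite sort_uniq fset_uniq.
have /tuple_permP[p Ep] : perm_eq (vertices A) v by apply: uniq_perm.
have tA i : tnth (vertices A) i = tnth v (p i).
  by rewrite (tnth_nth (tnth v i)) Ep -tnth_nth tnth_mktuple.
have lt_sorted (i j : 'I_k.+2) :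
    (tnth (vertices A) i < tnth (vertices A) j)%O = (i < j)%N.
  set x0 := tnth v ord0; rewrite !(tnth_nth x0).
  have sA : sorted <%O (vertices A).
    by rewrite lt_sorted_uniq_le uA /= sort_le_sorted.
  by rewrite (lt_sorted_ltn_nth x0 sA) ?inE ?size_tuple.
rewrite (@osimplexE _ v A) //.
have b0 : boundary (0 : chain k.+1) = 0.
  by rewrite (@boundaryEw _ fset0) ?msupp0 // big_seq_fset0.
have bZ a (x : chain k.+1) : boundary (a *: x) = a *: boundary x.
  by have := boundary_is_linear a x 0; rewrite !addr0 b0 addr0.
rewrite bZ boundaryU scaler_sumr [RHS](reindex_inj (@perm_inj _ p)).
apply: eq_bigr => i _ /=.
have uF := uniq_face (p i) uv.
have hB : ([fset x in tval (face (p i) v)]%fset \in C) &&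
    (#|` [fset x in tval (face (p i) v)]%fset| == k.+1).
  rewrite card_fseq undup_id // size_tuple eqxx andbT.
  apply: faces_sub vC _ _.
    apply/fset0Pn; exists (tnth (face (p i) v) ord0).
    by rewrite !inE mem_tnth.
  by apply/fsubsetP => x; rewrite !inE mem_face // => /andP[].
pose B : simplex k :=
  exist (fun A : {fset V} => (A \in C) && (#|` A| == k.+1)) _ hB.
have -> : osimplex (face (p i) v) =
    (-1) ^+ inversions (face (p i) v) *: mkmalgU B 1 by apply: osimplexE.
have -> : osimplex (face i (vertices A)) =
    (-1) ^+ inversions (face i (vertices A)) *: mkmalgU B 1.
  apply: osimplexE; apply/fsetP => x.
  by rewrite [val B]/= !inE !mem_face // mA tA.
move: (mkmalgU B 1 : chain k) => u.
suff E : (-1) ^+ inversions v * (-1) ^+ i * (-1) ^+ inversions (face i (vertices A))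
    = (-1) ^+ (p i) * (-1) ^+ inversions (face (p i) v) :> R.
  have scal a b (w : chain k) : a *: (b *: w) = (a * b) *: w by exact: scalerA.
  by rewrite !scal E.
rewrite -!exprD.
have [m] := inversions_face (p i) uv.
have -> : inversions (face i (vertices A)) = 0%N.
  rewrite inversionsE big1 // => a _; rewrite big1 // => b _.
  rewrite !tnth_face lt_sorted /= /bump; lia.
have -> : (\sum_(j < k.+2) (tnth v j < tnth v (p i))%O)%N = i.
  rewrite (reindex_inj (@perm_inj _ p)) [RHS]sum_ltn_ord.
  by apply: eq_bigr => j _; rewrite -!tA lt_sorted.
move=> E; rewrite addn0 -signr_odd E !oddD odd_double addbF -oddD signr_odd.
by rewrite addnC.
Qed.

Definition inner (k : nat) (sigma eta : chain k) : R :=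
  \sum_(A <- msupp sigma) mcoeff A sigma * mcoeff A eta.

(* The cochain eta^*. *)
Definition dual (k : nat) (eta : chain k) : chain k -> R :=
  fun sigma => inner sigma eta.

Definition weight (k : nat) (sigma eta : chain k) : R :=
  Num.max (dual eta sigma) 0.

Definition adj (k : nat) (sigma sigma' : chain k) : Prop :=
  exists2 tau : chain k.+1, oriented_simplexes tau &
    0 < weight sigma (boundary tau) /\ sigma' = sigma - boundary tau.

Definition transition (k : nat) (sigma sigma' : chain k) : R :=
  if `[< adj sigma sigma' >] then weight sigma (sigma - sigma')
  else if (sigma == 0) && (sigma' == 0) then 1 else 0.

(* The sum over the neighbours of sigma, as the difference of the sums of the
   positive and of the negative parts. When F is the indicator of a set that
   does not contain sigma, all terms are nonnegative and the value may be
   +oo. *)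
Definition generator (k : nat) (F : chain k -> R) (sigma : chain k) : \bar R :=
  let f sigma' := ((F sigma' - F sigma) * transition sigma sigma')%:E in
  (\esum_(sigma' in adj sigma) f^\+ sigma' -
   \esum_(sigma' in adj sigma) f^\- sigma')%E.

End Chains.

Section PureJump.
Context (R : realType) (dE : measure_display) (E : measurableType dE).
Variable L : (E -> R) -> E -> \bar R.

(* If L is the generator of a pure-jump process, this is the rate at which the
   process leaves x by a jump into B. *)
Definition jump_rate (x : E) (B : set E) : \bar R := L \1_(B `\ x) x.

Definition total_rate (x : E) : \bar R := jump_rate x setT.

(* x is absorbing when its total rate is 0. *)
Definition jump_law (x : E) (B : set E) : R :=
  if total_rate x == 0%E then \1_B x
  else fine (jump_rate x B) / fine (total_rate x).

Context (dT : measure_display) (T : measurableType dT) (P : probability T R).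

Definition past (Y : nat -> T -> E) (S : nat -> T -> \bar R) (n : nat)
    (U : nat -> set E) (s : nat -> R) : set T :=
  [set w | (forall i, (i <= n)%N -> U i (Y i w)) /\
           (forall i, (i < n)%N -> ((s i)%:E < S i w)%E)].

(* Y is the sequence of visited states and S that of the holding times. Given
   Y_0, S_0, ..., S_{n-1}, Y_n, the holding time S_n is exponential with
   parameter the total rate of Y_n (S_n = +oo if this rate is 0) and is
   independent of Y_{n+1}, which is drawn from the jump law of Y_n. The
   conditioning is tested on the cylinders that generate the past. *)
Definition jump_chain (Y : nat -> T -> E) (S : nat -> T -> \bar R) : Prop :=
  [/\ forall n, measurable_fun setT (Y n),
      forall n, measurable_fun setT (S n),
      forall n, {ae P, forall w, (total_rate (Y n w) < +oo)%E} &
      forall (n : nat) (U : nat -> set E) (s : nat -> R) (r : R) (B : set E),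
        (forall i, measurable (U i)) -> measurable B -> 0 <= r ->
        P (past Y S n U s `&` [set w | (r%:E < S n w)%E /\ B (Y n.+1 w)]) =
        (\int[P]_(w in past Y S n U s)
           (expR (- (fine (total_rate (Y n w)) * r)) *
            jump_law (Y n w) B)%:E)%E].

(* X is a pure-jump Markov process with generator L, with an arbitrary initial
   law: almost surely X_t = Y_n between the n-th and the (n+1)-st jump times
   S_0 + ... + S_{n-1} and S_0 + ... + S_n, and these intervals cover all
   t >= 0 (no explosion). *)
Definition pure_jump_markov (X : R -> T -> E) : Prop :=
  (forall t, 0 <= t -> measurable_fun setT (X t)) /\
  exists (Y : nat -> T -> E) (S : nat -> T -> \bar R), jump_chain Y S /\
    {ae P, forall w, forall t : R, 0 <= t -> exists n : nat,
      [/\ (\sum_(i < n) S i w <= t%:E)%E,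
          (t%:E < \sum_(i < n.+1) S i w)%E & X t w = Y n w]}.

End PureJump.

(* Main.v *)
(* Almost surely the holding times S_n are positive, and each jump
   Y_{n+1} - Y_n lies in D = im boundary, which gives the theorem since X_t and
   X_0 are both values of Y. The space of chains is uncountable and D is not
   visibly measurable, but S_k^+ is countable, so the pairs (x, y) with y - x
   not in D are covered by countably many products U * B of half-spaces such
   that no point of U can reach B; the law of the jump chain gives each event
   Y_n \in U, Y_{n+1} \in B probability 0. *)

Require Import Defs.
From HB Require Import structures.
From mathcomp Require Import all_boot all_order all_algebra finmap.
From mathcomp Require Import zify.
From mathcomp Require Import all_classical all_reals all_analysis.
From mathcomp Require Import measurable_realfun.
From mathcomp.multinomials Require Import -(notations) monalg.

Set Implicit Arguments.
Unset Strict Implicit.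
Unset Printing Implicit Defensive.

Import Order.TTheory GRing.Theory Num.Theory.

Local Open Scope classical_set_scope.
Local Open Scope ring_scope.

Local Arguments boundary : simpl never.

(** * The boundary of a boundary vanishes *)

Section BoundarySquare.
Context (R : realType) (d : Order.disp_t) (V : orderType d) (C : complex V).

HB.instance Definition _ k := GRing.isLinear.Build R (chain R C k)
  (chain R C k.-1) *:%R (@boundary R d V C k) (@boundary_is_linear R d V C k).

(* The terms cancel in pairs: (i, j) with j < i against (j, i - 1). *)
Lemma alternating_double_sum (M : lmodType R) (n : nat)
    (F : 'I_n.+2 -> 'I_n.+1 -> M) :
  (forall (i i' : 'I_n.+2) (j j' : 'I_n.+1), (j < i)%N ->
     i' = j :> nat -> i = j'.+1 :> nat -> F i j = F i' j') ->
  \sum_(i < n.+2) \sum_(j < n.+1) (-1) ^+ (i + j) *: F i j = 0 :> M.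
Proof.
move=> FE; rewrite pair_big /=.
rewrite (bigID (fun p : 'I_n.+2 * 'I_n.+1 => (p.2 < p.1)%N)) /=.
(* [h] and [g] are mutually inverse between the pairs with j < i and those with i <= j. The value of
   [inord] is the intended one on these domains, which is all that [hE] and [gE] retain. *)
pose h (p : 'I_n.+2 * 'I_n.+1) : 'I_n.+2 * 'I_n.+1 := (inord p.2, inord p.1.-1).
pose g (p : 'I_n.+2 * 'I_n.+1) : 'I_n.+2 * 'I_n.+1 := (inord p.2.+1, inord p.1).
have hE (p : 'I_n.+2 * 'I_n.+1) : (p.2 < p.1)%N ->
    (h p).1 = p.2 :> nat /\ p.1 = (h p).2.+1 :> nat.
  case: p => i j /= ji; have /= := ltn_ord i; have /= := ltn_ord j => ? ?.
  by rewrite !inordK; lia.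
have gE (p : 'I_n.+2 * 'I_n.+1) : ~~ (p.2 < p.1)%N ->
    (g p).1 = p.2.+1 :> nat /\ (g p).2 = p.1 :> nat.
  case: p => i j /= ji; have /= := ltn_ord i; have /= := ltn_ord j => ? ?.
  by rewrite !inordK; lia.
clearbody h g.
rewrite [X in _ + X](reindex_onto h g) /=; last first.
  move=> p np; have [g1 g2] := gE p np.
  have [|h1 h2] := hE (g p); first by rewrite g1 g2; lia.
  by rewrite [LHS]surjective_pairing [RHS]surjective_pairing; congr (_, _);
    apply/ord_inj; lia.
rewrite [X in _ + X](eq_bigl (fun p : 'I_n.+2 * 'I_n.+1 => (p.2 < p.1)%N)).
  rewrite -big_split /= big1// => p pP; have [h1 h2] := hE p pP.
  (* The exponents i + j and j + (i - 1) differ by one, so the signs are opposite. *)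
  rewrite (FE _ (h p).1 _ (h p).2)// h1 h2 -scalerDl.
  by rewrite addSn exprS [(p.2 + _)%N]addnC mulN1r addNr scale0r.
move=> p; apply/idP/idP => [/andP[ph /eqP gh]|pP].
  by have := gE _ ph; rewrite gh => -[g1 g2]; lia.
have [h1 h2] := hE p pP.
have ph : ~~ ((h p).2 < (h p).1)%N by lia.
have [g1 g2] := gE _ ph; rewrite ph /=.
by apply/eqP; rewrite [LHS]surjective_pairing [RHS]surjective_pairing;
  congr (_, _); apply/ord_inj; lia.
Qed.

(** The simplicial identity d_j d_i = d_{i-1} d_j for j < i. *)
Lemma face_face (n : nat) (v : n.+2.-tuple V) (i i' : 'I_n.+2)
    (j j' : 'I_n.+1) : (j < i)%N -> i' = j :> nat -> i = j'.+1 :> nat ->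
  face j (face i v) = face j' (face i' v).
Proof.
move=> ji ij ji'; apply: eq_from_tnth => l; rewrite !tnth_face.
by congr (tnth v _); apply/val_inj; rewrite /= /bump; lia.
Qed.

(** By linearity a single basis simplex is enough; its faces lie in [C], so [boundary_osimplex]
    applies to them and leaves an alternating sum over double faces. *)
Lemma boundary_boundary (k : nat) (sigma : chain R C k.+1) :
  boundary (boundary sigma : chain R C k) = 0.
Proof.
case: k sigma => [//|k] sigma.
have -> : boundary sigma = \sum_(A <- msupp sigma) mcoeff A sigma *:
    \sum_(i < k.+3) (-1) ^+ i *: osimplex R C (face i (vertices A))
    :> chain R C k.+1.
  exact: (boundaryEw (fsubset_refl _)).
rewrite linear_sum big1// => A _.
rewrite linearZ/= [X in _ *: X](_ : _ = 0) ?scaler0//.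
rewrite linear_sum.
have uv : uniq (vertices A) by rewrite sort_uniq fset_uniq.
have vC i : [fset x in tval (face i (vertices A))]%fset \in C.
  have /andP[memA _] := valP A; apply: faces_sub memA _ _.
    apply/fset0Pn; exists (tnth (face i (vertices A)) ord0).
    by rewrite !inE mem_tnth.
  apply/fsubsetP => x; rewrite !inE mem_face// => /andP[].
  by rewrite mem_sort.
rewrite (eq_bigr (fun i : 'I_k.+3 => \sum_(j < k.+2) (-1) ^+ (i + j) *:
    osimplex R C (face j (face i (vertices A))))); last first.
  move=> i _; rewrite linearZ/= boundary_osimplex//; last exact: uniq_face.
  by rewrite scaler_sumr; apply: eq_bigr => j _; rewrite exprD scalerA.
apply: (@alternating_double_sum (chain R C k)) => i i' j j' ji ij ij'.
by rewrite (face_face _ ji ij ij').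
Qed.

End BoundarySquare.

(** * Subspaces of chains and their separation by measurable rectangles *)

(** A matrix of maximal rank among those with rows in [S] has row space [S], since appending a
    further vector of [S] cannot raise the rank; [N] is its cokernel. *)
Lemma subspace_kermx (F : fieldType) (n : nat) (S : set 'rV[F]_n) : S 0 ->
  (forall a u v, S u -> S v -> S (a *: u + v)) ->
  exists N : 'M[F]_n, forall u, S u <-> u *m N = 0.
Proof.
move=> S0 Slin.
have Smul m (u : 'rV[F]_m) (M : 'M[F]_(m, n)) :
    (forall i, S (row i M)) -> S (u *m M).
  move=> SM; rewrite mulmx_sum_row; elim/big_ind : _ => //.
  - by move=> x y Sx Sy; rewrite -[x]scale1r; exact: Slin.
  - by move=> i _; rewrite -[X in S X]addr0; exact: Slin.
pose Q r := `[< exists M : 'M[F]_n, (forall i, S (row i M)) /\ \rank M = r >].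
have Q0 : exists r, Q r.
  by exists 0%N; apply/asboolP; exists 0; rewrite mxrank0; split=> // i;
    rewrite row0.
have Qn r : Q r -> (r <= n)%N.
  by move=> /asboolP[M [_ <-]]; exact: rank_leq_row.
case: (ex_maxnP Q0 Qn) => r /asboolP[M [SM <-]] Mmax.
exists (cokermx M) => u; split=> [Su|/eqP]; last first.
  by rewrite -submxE => /submxP[D ->]; exact: Smul.
apply/eqP; rewrite -submxE.
have /leq_trans := mxrankS (addsmxSl M u).
have := mxrank_leqif_sup (addsmxSl M u) => -[_ rE] _.
apply: (submx_trans (addsmxSr M u)); rewrite -rE eqn_leq mxrankS ?addsmxSl//=.
apply: Mmax; apply/asboolP; exists (M + u)%MS; split=> // i.
have /sub_addsmxP[[a b] /= ->] := row_sub i (M + u)%MS.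
rewrite -[a *m M]scale1r; apply: Slin; first exact: Smul.
by apply: Smul => j; rewrite [j]ord1 row_id.
Qed.

Section Rectangles.
Context (R : realType) (d : Order.disp_t) (V : orderType d) (C : complex V).

Lemma countable_simplex (k : nat) :
  countable [set: V] -> countable [set: simplex C k].
Proof.
move=> /countable_injP[v vinj]; apply/countable_injP.
exists (fun A : simplex C k => CodeSeq.code (map v (enum_fset (val A)))).
move=> A B _ _ AB.
apply/val_inj/fsetP => x; have {AB} := can_inj CodeSeq.codeK AB.
have memE (D : {fset V}) y : (y \in D) = (v y \in map v (enum_fset D)).
  by rewrite mem_map// => a b; apply: vinj; rewrite inE.
by move=> AB; rewrite !memE AB.
Qed.

(** The inverse [h] of the numbering [e] is partial, so that finite and empty types are covered as
    well. *)
Lemma countable_enum (I : Type) : countable [set: I] ->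
  exists (e : I -> nat) (h : nat -> option I),
    forall i n, h n = Some i <-> e i = n.
Proof.
move=> /countable_injP[e einj].
exists e, (fun n => if pselect (exists i, e i = n) is left H
                    then Some (projT1 (cid H)) else None) => i n.
case: pselect => [H|nH]; last by split=> // ein; case: nH; exists i.
case: cid => j /= ejn; split=> [[<-]//|ein]; congr Some.
by apply: einj; rewrite ?inE// ein.
Qed.

Lemma measurable_mcoeff (k : nat) (A : simplex C k) :
  measurable_fun setT (mcoeff A : chain R C k -> R).
Proof.
move=> _ U mU; rewrite setTI; apply: sub_sigma_algebra.
by exists A, U.
Qed.

(* A subspace of chains is closed for the finest locally convex topology, of
   which countably many linear forms give enough rational half-spaces. *)
Lemma separating_rectangles (k : nat) (D : set (chain R C k)) :
  countable [set: V] -> D 0 ->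
  (forall a x y, D x -> D y -> D (a *: x + y)) ->
  exists (I : countType) (U B : I -> set (chain R C k)),
    [/\ forall i, measurable (U i), forall i, measurable (B i),
        forall i x y, U i x -> B i y -> ~ D (y - x) &
        forall x y, ~ D (y - x) -> exists i, U i x /\ B i y].
Proof.
move=> /(countable_simplex k)/countable_enum[e [h eh]] D0 Dlin.
pose c i (x : chain R C k) : R := if h i is Some A then mcoeff A x else 0.
have ce A x : c (e A) x = mcoeff A x.
  by rewrite /c; have /eh -> : e A = e A by [].
have mc i : measurable_fun setT (c i).
  rewrite /c; case: (h i) => [A|]; last exact: measurable_cst.
  exact: measurable_mcoeff.
have clin i a x y : c i (a *: x + y) = a * c i x + c i y.
  by rewrite /c; case: (h i) => [A|]; rewrite ?mulr0 ?addr0// mcoeffD mcoeffZ.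
have c0 i : c i 0 = 0 by rewrite /c; case: (h i) => // A; rewrite mcoeff0.
have cN i x : c i (- x) = - c i x.
  by rewrite -[- x]addr0 -scaleN1r clin c0 mulN1r addr0.
have csep x y : (forall i, c i x = c i y) -> x = y.
  by move=> cxy; apply/malgP => A; rewrite -!ce.
(* The chains supported on the first [m] coordinates: finite-dimensional measurable subspaces that
   increase to the whole space. *)
pose E m : set (chain R C k) := [set x | forall i, (m <= i)%N -> c i x = 0].
have mE m : measurable (E m).
  rewrite (_ : E m = \bigcap_i (c (m + i)%N @^-1` [set 0])); last first.
    apply/seteqP; split=> x /= Ex i; first by move=> _; apply: Ex; lia.
    by move=> mi; rewrite -(subnKC mi); exact: Ex.
  apply: bigcapT_measurable => i.
  by rewrite -[X in measurable X]setTI; exact: mc.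
have EE x : exists m, E m x.
  exists (\max_(A <- msupp x) (e A).+1)%N => i mi; rewrite /c.
  case hi : (h i) => [A|//]; apply: mcoeff_outdom; apply/negP => Ax.
  move/eh : hi mi => <-; apply/negP; rewrite -ltnNge.
  by rewrite (big_rem A)//= leq_maxl.
have EW m n x : (m <= n)%N -> E m x -> E n x.
  by move=> mn Ex i ni; apply: Ex; exact: leq_trans ni.
pose r m x : 'rV[R]_m := \row_(i < m) c i x.
have rlin m a x y : r m (a *: x + y) = a *: r m x + r m y.
  by apply/rowP => i; rewrite !mxE clin.
have rinj m x y : E m x -> E m y -> r m x = r m y -> x = y.
  move=> Ex Ey rxy; apply: csep => i; have [mi|im] := leqP m i.
    by rewrite Ex// Ey.
  by have := congr1 (fun u : 'rV[R]_m => u 0 (Ordinal im)) rxy; rewrite !mxE.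
have Elin m a x y : E m x -> E m y -> E m (a *: x + y).
  by move=> Ex Ey i mi; rewrite clin Ex// Ey// mulr0 addr0.
(* Within [E m], membership in [D] amounts to finitely many linear equations. *)
have /all_sig[N NE] m :
    {N : 'M[R]_m | forall x, E m x -> D x <-> r m x *m N = 0}.
  apply/cid.
  have [||N NE] := @subspace_kermx R m [set r m x | x in E m `&` D].
  - exists 0; first by split=> // i _; exact: c0.
    by apply/rowP => i; rewrite !mxE c0.
  - move=> a _ _ [x [Ex Dx] <-] [y [Ey Dy] <-]; exists (a *: x + y).
      by split; [exact: Elin|exact: Dlin].
    exact: rlin.
  - exists N => x Ex; rewrite -NE; split=> [Dx|[y [Ey Dy]] /rinj <-//].
    by exists x.
(* These are the equations of [D] on [E m]; the sign [s] allows a nonzero value to be taken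
   positive. *)
pose phi m (j : 'I_m) (s : bool) x : R := (-1) ^+ s * (r m x *m N m) 0 j.
have mphi m j s : measurable_fun setT (@phi m j s).
  apply: measurable_funM; first exact: measurable_cst.
  under eq_fun do rewrite mxE; apply: measurable_sum => i.
  under eq_fun do rewrite mxE.
  by apply: measurable_funM; [exact: mc|exact: measurable_cst].
have philin m j s x y : @phi m j s (y - x) = phi m j s y - phi m j s x.
  rewrite /phi -mulrBr; congr (_ * _).
  rewrite addrC -scaleN1r rlin mulmxDl -scalemxAl mxE [X in X + _]mxE.
  by rewrite mulN1r addrC.
(* An index consists of a dimension, an equation, a sign and a rational threshold q; the rectangle
   is phi < q on the left and phi > q on the right, so that phi (y - x) > 0. *)
pose I : Type := ({m : nat & 'I_m} * bool * rat)%type.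
exists I,
  (fun i => E (projT1 i.1.1) `&`
    [set x | phi _ (projT2 i.1.1) i.1.2 x < ratr i.2]),
  (fun i => E (projT1 i.1.1) `&`
    [set x | ratr i.2 < phi _ (projT2 i.1.1) i.1.2 x]).
split.
- move=> i; apply: measurableI => //.
  rewrite (_ : mkset _ =
      phi _ (projT2 i.1.1) i.1.2 @^-1` `]-oo, ratr i.2[%classic).
    by rewrite -[X in measurable X]setTI; exact: mphi.
  by apply/seteqP; split=> x /=; rewrite in_itv.
- move=> i; apply: measurableI => //.
  rewrite (_ : mkset _ =
      phi _ (projT2 i.1.1) i.1.2 @^-1` `]ratr i.2, +oo[%classic).
    by rewrite -[X in measurable X]setTI; exact: mphi.
  by apply/seteqP; split=> x /=; rewrite in_itv/= andbT.
- move=> [[[m j] s] q] x y /= [Ex xq] [Ey qy] Dyx.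
  have Exy : E m (y - x) by rewrite addrC -scaleN1r; exact: Elin.
  have := lt_trans xq qy; rewrite -subr_gt0 -philin /phi.
  by move/NE : Dyx => ->//; rewrite mxE mulr0 ltxx.
- move=> x y nD; have [m1 Ex] := EE x; have [m2 Ey] := EE y.
  pose m := maxn m1 m2.
  have {}Ex : E m x by apply: EW Ex; exact: leq_maxl.
  have {}Ey : E m y by apply: EW Ey; exact: leq_maxr.
  have Exy : E m (y - x) by rewrite addrC -scaleN1r; exact: Elin.
  have /rV0Pn[j] : r m (y - x) *m N m != 0.
    by apply/eqP => rN0; apply/nD/(NE m _ Exy).
  move=> rj.
  have [s phis] : exists s, 0 < phi m j s (y - x).
    have [rlt|rgt|r0] := ltgtP ((r m (y - x) *m N m) 0 j) 0.
    + by exists true; rewrite /phi mulN1r oppr_gt0.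
    + by exists false; rewrite /phi mul1r.
    + by rewrite r0 eqxx in rj.
  move: phis; rewrite philin subr_gt0 => /rat_in_itvoo[q]; rewrite in_itv/=.
  by move=> /andP[xq qy]; exists (existT _ m j, s, q).
Qed.

End Rectangles.

(** * Almost sure properties of a jump chain *)

Section PureJump.
Context (R : realType) (dE : measure_display) (E : measurableType dE).
Context (L : (E -> R) -> E -> \bar R).
Context (dT : measure_display) (T : measurableType dT) (P : probability T R).

Lemma ae_forall_countType (I : countType) (Q : I -> T -> Prop) :
  (forall i, {ae P, forall w, Q i w}) -> {ae P, forall w, forall i, Q i w}.
Proof.
move=> QP.
have : {ae P, forall w, forall n,
    if choice.unpickle n is Some i then Q i w else True}.
  apply: ae_foralln => n; case: (choice.unpickle n) => [i|]; first exact: QP.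
  exact: aeW.
by apply: filterS => w Qw i; have := Qw (choice.pickle i); rewrite choice.pickleK.
Qed.

(* Monotonicity of the integral is not available, as jump laws are not known to
   be measurable; the indicator of A minus a null set is a simple function
   below f. *)
Lemma ge0_integral_ge_ae1 (A : set T) (f : T -> \bar R) : measurable A ->
  (forall w, (0 <= f w)%E) -> {ae P, forall w, f w = 1%E} ->
  (P A <= \int[P]_(w in A) f w)%E.
Proof.
move=> mA f0 [N [mN PN0 fN]]; have mAN : measurable (A `\` N) by exact: measurableD.
have -> : P A = P (A `\` N).
  apply/eqP; rewrite eq_le; apply/andP; split; last first.
    by apply: le_measure; rewrite ?inE//; exact: subDsetl.
  have := measureU2 P mAN mN; rewrite [X in (_ <= _ + X)%E]PN0 adde0; apply: le_trans.
  apply: le_measure; rewrite ?inE//; first exact: measurableU.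
  by move=> w Aw; have [Nw|Nw] := pselect (N w); [right|left].
rewrite ge0_integralE//.
apply: ereal_sup_ubound; exists (indic_nnsfun R mAN); last exact: sintegral_indic.
move=> w; rewrite patchE /= mindicE; case: ifPn => wA.
  have [wN|wN] := pselect (N w).
    by rewrite memNset ?f0// => -[].
  rewrite mem_set; last by split=> //; exact/set_mem.
  by have -> : f w = 1%E by apply: contrapT => fw; exact/wN/fN.
by rewrite memNset// => -[/mem_set]; rewrite (negbTE wA).
Qed.

Context (Y : nat -> T -> E) (S : nat -> T -> \bar R).
Context (YS : jump_chain L P Y S).

Let positive (n : nat) : set T := [set w | forall i, (i < n)%N -> (0 < S i w)%E].

Let measurable_gt0 n : measurable [set w | (0 < S n w)%E].
Proof.
have [_ mS _ _] := YS; rewrite -[X in measurable X]setTI.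
by apply: emeasurable_fun_o_infty => //; exact: mS.
Qed.

Let measurable_positive n : measurable (positive n).
Proof.
rewrite (_ : positive n = \bigcap_(i in [set i | (i < n)%N])
  [set w | (0 < S i w)%E])//.
exact: bigcap_measurableType.
Qed.

(** The law of the chain is tested on events S_n > r with r >= 0, so [jump_avoids] speaks only of
    positive holding times; this lemma lifts that restriction. It holds because an exponential
    survival function equals 1 at r = 0. *)
Lemma holding_times_gt0 :
  (forall x B, 0 <= jump_law L x B) ->
  (forall x, (total_rate L x < +oo)%E -> jump_law L x setT = 1) ->
  {ae P, forall w, forall n, (0 < S n w)%E}.
Proof.
have [mY mS finS law] := YS; move=> L0 L1.
have P1 n : P (positive n) = 1%E.
  elim: n => [|n IH].
    by rewrite (_ : positive 0 = setT) ?probability_setT//; apply/seteqP; split.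
  apply/eqP; rewrite eq_le probability_le1//= -IH.
  (* With no constraint on the states and all thresholds 0, the law expresses the probability of
     [positive n.+1] as an integral over [positive n]. *)
  have := law n (fun=> setT) (fun=> 0) 0 setT
    (fun=> measurableT) measurableT (lexx 0).
  rewrite (_ : past _ _ _ _ _ = positive n); last first.
    by apply/seteqP; split=> w /=; [case|move=> Sw; split].
  rewrite (_ : _ `&` _ = positive n.+1); last first.
    apply/seteqP; split=> w /=.
      by move=> [Sw [S0 _]] i; rewrite ltnS leq_eqVlt => /predU1P[->//|/Sw].
    by move=> Sw; split=> [i im|]; [exact/Sw/ltnW|split=> //; exact: Sw].
  move=> ->; apply: ge0_integral_ge_ae1 => //.
    by move=> w; rewrite lee_fin mulr_ge0 ?expR_ge0.
  apply: filterS (finS n) => w /L1 ->.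
  by rewrite mulr0 oppr0 expR0 mulr1.
apply: ae_foralln => n; exists (~` positive n.+1); split.
- exact: measurableC.
- by have := probability_setC P (measurable_positive n.+1); rewrite P1 subee.
- by move=> w /= Sw Sp; apply: Sw; exact: Sp.
Qed.

(** When only Y_n is constrained, to lie in [U], the integrand in the law vanishes on the whole
    past, so the forbidden event is null. *)
Lemma jump_avoids (n : nat) (U B : set E) : measurable U -> measurable B ->
  (forall x, U x -> jump_law L x B = 0) ->
  {ae P, forall w, (forall i, (0 < S i w)%E) -> U (Y n w) -> ~ B (Y n.+1 w)}.
Proof.
have [mY mS finS law] := YS; move=> mU mB UB0.
pose Un i := if i == n then U else setT.
have mUn i : measurable (Un i) by rewrite /Un; case: ifP.
have := law n Un (fun=> 0) 0 B mUn mB (lexx 0).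
rewrite integral0_eq; last first.
  by move=> w [/(_ n (leqnn n))]; rewrite /Un eqxx => /UB0 -> _; rewrite mulr0.
set N := (X in P X) => PN0; exists N; split=> //.
  rewrite (_ : N = positive n `&` Y n @^-1` U `&`
      ([set w | (0 < S n w)%E] `&` Y n.+1 @^-1` B)).
    apply: measurableI; first apply: measurableI => //.
      by rewrite -[X in measurable X]setTI; exact: mY.
    by apply: measurableI => //; rewrite -[X in measurable X]setTI; exact: mY.
  apply/seteqP; split=> w /=.
    move=> [[Uw Sw] SB]; split=> //; split=> //.
    by have := Uw n (leqnn n); rewrite /Un eqxx.
  move=> [[Sw Uw] SB]; split=> //; split=> // i _; rewrite /Un.
  by case: eqP => [->|].
move=> w /= /not_implyP[Sw] /not_implyP[Uw] /contrapT Bw.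
split; last by split=> //; exact: Sw.
by split=> [i _|i _]; [rewrite /Un; case: eqP => [->|]|exact: Sw].
Qed.

End PureJump.

(** * Jump rates and jump laws of the walk on chains *)

Section WalkRates.
Context (R : realType) (d : Order.disp_t) (V : orderType d) (C : complex V).
Context (k : nat).

Local Notation L := (@generator R d V C k).

Lemma weight_ge0 (sigma eta : chain R C k) : 0 <= weight sigma eta.
Proof. by rewrite /weight le_max lexx orbT. Qed.

Lemma transition_ge0 (sigma sigma' : chain R C k) : 0 <= transition sigma sigma'.
Proof.
by rewrite /transition; case: ifP => _; [exact: weight_ge0|case: ifP].
Qed.

(** The indicator of [B] without [x] vanishes at [x], so every term is nonnegative and the sum of
    negative parts is 0. *)
Lemma jump_rateE (x : chain R C k) (B : set (chain R C k)) :
  jump_rate L x B =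
  (\esum_(y in adj x) ((\1_(B `\ x) y * transition x y)%:E : \bar R))%E.
Proof.
rewrite /jump_rate /generator.
have x0 : \1_(B `\ x) x = 0 :> R by rewrite indicE memNset// => -[_]; exact.
have f0 y : (0 <= ((\1_(B `\ x) y - \1_(B `\ x) x) * transition x y)%:E :> \bar R)%E.
  by rewrite x0 subr0 lee_fin mulr_ge0 ?transition_ge0.
rewrite [X in (_ - X)%E]esum1 ?sube0.
  apply: eq_esum => y _.
  by rewrite (ge0_funeposE (fun z (_ : setT z) => f0 z)) ?inE// x0 subr0.
by move=> y _; rewrite (ge0_funenegE (fun z (_ : setT z) => f0 z)) ?inE.
Qed.

Lemma jump_rate_ge0 (x : chain R C k) (B : set (chain R C k)) :
  (0 <= jump_rate L x B)%E.
Proof.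
rewrite jump_rateE; apply: esum_ge0 => y _.
by rewrite lee_fin mulr_ge0 ?transition_ge0.
Qed.

Lemma jump_law_ge0 (x : chain R C k) (B : set (chain R C k)) :
  0 <= jump_law L x B.
Proof.
rewrite /jump_law; case: ifP => _ //.
by rewrite divr_ge0// fine_ge0// jump_rate_ge0.
Qed.

Lemma jump_law_setT (x : chain R C k) :
  (total_rate L x < +oo)%E -> jump_law L x setT = 1.
Proof.
rewrite /jump_law => xoo; case: ifPn => [_|x0]; first by rewrite indicT.
have x_ge0 : (0 <= total_rate L x)%E by exact: jump_rate_ge0.
rewrite divff// fine_eq0// ge0_fin_numE//.
Qed.

(** The hypothesis on [x] itself serves absorbing states, whose jump law is the point mass at
    [x]. *)
Lemma jump_law_unreachable (x : chain R C k) (B : set (chain R C k)) :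
  ~ B x -> (forall y, adj x y -> ~ B y) -> jump_law L x B = 0.
Proof.
move=> Bx adjB; rewrite /jump_law; case: ifPn => _.
  by rewrite indicE memNset.
rewrite jump_rateE esum1 ?mul0r// => y /adjB By.
by rewrite indicE memNset ?mul0r// => -[].
Qed.

End WalkRates.

(** * Homology classes along the walk *)

Lemma jump_chain_homologous (R : realType) (d : Order.disp_t) (V : orderType d)
    (C : complex V) (k : nat) (dT : measure_display) (T : measurableType dT)
    (P : probability T R) (Y : nat -> T -> chain R C k) (S : nat -> T -> \bar R) :
  countable [set: V] -> jump_chain (@generator R d V C k) P Y S ->
  {ae P, forall w, forall n m,
     exists eta : chain R C k.+1, Y n w - Y m w = boundary eta}.
Proof.
move=> cV YS; pose D : set (chain R C k) := range (@boundary R d V C k.+1).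
have D0 : D 0 by exists 0 => //; rewrite linear0.
have Dlin a x y : D x -> D y -> D (a *: x + y).
  by move=> [s _ <-] [t _ <-]; exists (a *: s + t) => //; rewrite linearP.
have [I [U [B [mU mB UB nD]]]] := separating_rectangles cV D0 Dlin.
have stepD : {ae P, forall w, forall n i,
    (forall i, (0 < S i w)%E) -> U i (Y n w) -> ~ B i (Y n.+1 w)}.
  apply: ae_foralln => n; apply: ae_forall_countType => i.
  apply: (jump_avoids YS) => // x Ux.
  (* No rectangle can contain a pair (x, x), since [D] contains 0, nor a pair of neighbours, since x
     - boundary tau differs from x by the boundary of - tau. *)
  apply: jump_law_unreachable => [Bx|_ [tau _ [_ ->]] By].
    by apply: UB Ux Bx _; rewrite subrr.
  apply: UB Ux By _; exists (- tau) => //.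
  by rewrite linearN/= addrC addKr.
have S_gt0 := holding_times_gt0 YS
  (@jump_law_ge0 _ _ _ _ _) (@jump_law_setT _ _ _ _ _).
apply: filterS2 S_gt0 stepD => w Sw Dw n m.
have YD j : D (Y j w - Y 0 w).
  elim: j => [|j IH]; first by rewrite subrr.
  rewrite -(subrKA (Y j w)) -[X in X + _]scale1r; apply: Dlin => //.
  (* A step outside [D] would fall into one of the rectangles, all of which are avoided at [w]. *)
  by apply: contrapT => /nD[i [Ui Bi]]; exact: Dw Ui Bi.
have [eta _ etaE] : D (Y n w - Y m w); last by exists eta.
by rewrite -(subrKA (Y 0 w)) -(opprB (Y m w)) addrC -scaleN1r; exact: Dlin.
Qed.

Theorem theorem17 (R : realType) (d : Order.disp_t) (V : orderType d)
    (C : complex V) (k : nat)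
    (dT : measure_display) (T : measurableType dT) (P : probability T R)
    (X : R -> T -> chain R C k) :
  countable [set: V] ->
  (1 <= k)%N ->
  pure_jump_markov (@generator R d V C k) P X ->
  {ae P, forall w, forall t : R, 0 < t ->
     exists eta : chain R C k.+1, X t w - X 0 w = boundary eta} /\
  {ae P, forall w, boundary (X 0 w) = 0 ->
     forall t : R, 0 <= t -> boundary (X t w) = 0}.
Proof.
move=> cV k_gt0 [_ [Y [S [YS XY]]]].
have XD : {ae P, forall w, forall t : R, 0 <= t ->
     exists eta : chain R C k.+1, X t w - X 0 w = boundary eta}.
  apply: filterS2 XY (jump_chain_homologous cV YS).
  move=> w Xw Yw t t0; have [n [_ _ ->]] := Xw t t0.
  (* X_0 is some Y_m, with m the index of the interval that contains time 0; hence the comparison of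
     two arbitrary indices above. *)
  by have [m [_ _ ->]] := Xw 0 (lexx 0).
split; first by apply: filterS XD => w Xw t /ltW; exact: Xw.
apply: filterS XD => w Xw X0 t /Xw[eta etaE].
by rewrite -[X t w](subrK (X 0 w)) etaE linearD/= X0 addr0 boundary_boundary.
Qed.
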